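(* Let $n\ge 1$ be an integer. For every deterministic strategy for Permutation Wordle on $[n]$ and every integer $d\ge 0$, the number of permutations in $S_n$ that the strategy solves within $d+1$ guesses is at most $\sum_{k=0}^{d} A(n,k)$.
   Context: Let $[n]=\{1,\dots,n\}$ and let $S_n$ be the group of permutations of $[n]$. Permutation Wordle: a setter fixes a secret $\sigma\in S_n$. In round $r=1,2,\dots$ the guesser submits a word $\gamma_r\in[n]^n$ (not necessarily a permutation), regarded as a function $\gamma_r:[n]\to[n]$ from positions to values, and receives the feedback $U_r=\{i\in[n] : \gamma_r(i)=\sigma(i)\}$. A deterministic strategy is a rule specifying, for each $r\ge 1$, the guess $\gamma_r\in[n]^n$ as a function of the previous feedback $(U_1,\dots,U_{r-1})$. The strategy solves $\sigma$ within $r$ guesses if, when played against the secret $\sigma$, it makes $\gamma_j=\sigma$ for some $1\le j\le r$. An excedance of $\pi\in S_n$ is a position $i\in[n]$ with $\pi(i)>i$; $\mathrm{exc}(\pi)$ is the number of excedances of $\pi$. The Eulerian number is $A(n,k)=|\{\pi\in S_n : \mathrm{exc}(\pi)=k\}|$. *)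

(* Defs.v *)
From mathcomp Require Import all_boot all_fingroup.

Set Implicit Arguments.
Unset Strict Implicit.
Unset Printing Implicit Defensive.

(* Positions and values, 1, ..., n on paper, are the elements 0, ..., n - 1 of
   'I_n; every notion below depends only on their order. *)

Definition word (n : nat) := {ffun 'I_n -> 'I_n}.

Definition feedback (n : nat) (g : word n) (s : 'S_n) : {set 'I_n} :=
  [set i | g i == s i].

(* The argument is the list [:: U_1; ...; U_(r-1)] in chronological order; its
   size determines the round r. *)
Definition strategy (n : nat) := seq {set 'I_n} -> word n.

(* [:: U_1; ...; U_m], when St is played against the secret s. *)
Fixpoint history (n : nat) (St : strategy n) (s : 'S_n) (m : nat) :
    seq {set 'I_n} :=
  if m is m'.+1 then
    let h := history St s m' in rcons h (feedback (St h) s)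
  else [::].

(* The guess of round r, for r >= 1. *)
Definition guess (n : nat) (St : strategy n) (s : 'S_n) (r : nat) : word n :=
  St (history St s r.-1).

(* The index j < r stands for round j + 1. *)
Definition solves_within (n : nat) (St : strategy n) (s : 'S_n) (r : nat) :
    bool :=
  [exists j : 'I_r, guess St s j.+1 == [ffun i => s i]].

Definition exc (n : nat) (p : 'S_n) : nat := #|[set i : 'I_n | i < p i]|.

Definition eulerian (n k : nat) : nat := #|[set p : 'S_n | exc p == k]|.

(* Main.v *)
From HB Require Import structures.
Require Import Defs.
From mathcomp Require Import all_boot all_fingroup all_algebra zify.

(** The bound is proved by the polynomial method. Fix distinct elements c_v of
    a field, read a permutation s as the point (c_(s 1), ..., c_(s n)), and let
    U_e be the space of functions on S_n spanned by the monomials in n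
    variables with every exponent smaller than e ([perm_poly]).

    A strategy yields independent elements of U_(d+1). For a secret s solved
    within d + 1 guesses, let f_s be the product, over the positions i and the
    first d rounds in which the guess misses at i, of x_i - c_(guess at i).
    Then f_s(s) is nonzero. If f_s(t) is nonzero too, then t also misses
    wherever s does, so at the first round where the two games differ the
    feedback for t is a proper subset of the feedback for s. Hence the f_s are
    triangular for the lexicographic order on feedback sizes, and the number of
    solved secrets is at most dim U_(d+1) ([card_solved_leq_dim]).

    For d >= n every permutation is counted on the right. For d < n, the
    dimension of U_(d+1) is bounded by duality. If a + b <= n, then U_a and
    U_b are orthogonal for the nondegenerate form that sends (f, g) to the sum
    of sgn(s) f(s) g(s): on monomials this sum is a determinant with rows
    (c_v ^ k)_v for n exponents k < n - 1, so two rows coincide. Therefore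
    dim U_(d+1) + dim U_(n-d-1) <= n! ([dim_perm_polyD]).

    It remains to see that U_(n-d-1) has dimension at least the number of
    permutations with more than d excedances ([card_exc_leq_dim]). These numbers
    satisfy a recursion in n, by inserting the largest letter into a cycle
    ([card_leq_exc_rec]), and the dimensions satisfy the same recursion as an
    inequality, by splitting S_n according to the value v taken at the first position
    ([sum_dim_perm_poly_lift]). The key point there is that the product of the
    c_v - x_i over all positions i except the first, although of degree one in
    each variable, vanishes on S_n exactly when v is not the value at the first
    position. *)

Set Implicit Arguments.
Unset Strict Implicit.
Unset Printing Implicit Defensive.

(** * Spaces of functions on a finite set *)

Section FunctionSpaces.
Import GRing.Theory.
Local Open Scope ring_scope.

Lemma span_ffun_ind (F : fieldType) (T : finType) (X : seq {ffun T -> F^o})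
    (P : {ffun T -> F^o} -> Prop) :
    P 0 -> (forall (a : F) f g, P f -> P g -> P [ffun x => a * f x + g x]) ->
    (forall f, f \in X -> P f) ->
  forall f, f \in <<X>>%VS -> P f.
Proof.
move=> P0 PD PX f Xf; rewrite (@coord_span _ _ _ (in_tuple X) _ Xf).
apply: (big_rec P) => // i g _ Pg.
suff -> : coord (in_tuple X) i f *: (in_tuple X)`_i + g =
    [ffun x => coord (in_tuple X) i f * X`_i x + g x].
  by apply: PD => //; apply/PX/mem_nth.
by apply/ffunP => x; rewrite !ffunE.
Qed.

Definition pullback (F : fieldType) (S T : finType) (h : S -> T)
  (f : {ffun T -> F^o}) : {ffun S -> F^o} := [ffun x => f (h x)].

Fact pullback_is_linear (F : fieldType) (S T : finType) (h : S -> T) :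
  linear (@pullback F S T h).
Proof. by move=> a f g; apply/ffunP => x; rewrite !ffunE. Qed.

HB.instance Definition _ (F : fieldType) (S T : finType) (h : S -> T) :=
  GRing.isLinear.Build F {ffun T -> F^o} {ffun S -> F^o} _ (@pullback F S T h)
    (@pullback_is_linear F S T h).

Lemma lker_pullbackP (F : fieldType) (S T : finType) (h : S -> T)
    (f : {ffun T -> F^o}) :
  reflect (forall x, f (h x) = 0) (f \in lker (linfun (@pullback F S T h))).
Proof.
rewrite memv_ker lfunE; apply: (iffP eqP) => [/ffunP f0 x | f0].
  by have := f0 x; rewrite !ffunE.
by apply/ffunP => x; rewrite !ffunE f0.
Qed.

(** A family of functions that is triangular for [rho] is independent. The point
    of largest [rho] is removed first: the functions attached to all other points
    vanish there, so they lie in a proper subspace of [V]. *)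
Lemma leq_card_dim_triangular (F : fieldType) (T : finType)
    (V : {vspace {ffun T -> F^o}}) (rho : T -> nat) (A : {set T}) :
    (forall x, x \in A -> exists2 f : {ffun T -> F^o}, f \in V & f x != 0 /\
       forall y, y \in A -> y != x -> (rho x <= rho y)%N -> f y = 0) ->
  (#|A| <= \dim V)%N.
Proof.
have [m] := ubnP #|A|; elim: m V A => // m IHm V A ltAm fA.
have [-> | [x0 Ax0]] := set_0Vmem A; first by rewrite cards0.
pose x := [arg max_(x > x0 in A) rho x].
have [Ax max_x] : x \in A /\ forall y, y \in A -> (rho y <= rho x)%N.
  by rewrite /x; case: arg_maxnP.
pose K := (V :&: lker (linfun (@pullback F unit T (fun=> x))))%VS.
have [f Vf [fx0 _]] := fA x Ax.
have ltKV : (\dim K < \dim V)%N.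
  rewrite ltn_neqAle dimvS ?capvSl // andbT (dimv_leqif_eq (capvSl _ _)).
  apply: contra fx0 => /eqP KV; move: Vf; rewrite -KV => /memv_capP[_].
  by move/lker_pullbackP/(_ tt)=> ->.
rewrite (cardsD1 x) Ax; apply: leq_trans ltKV; rewrite add1n ltnS.
apply: IHm => [|y]; first by rewrite (cardsD1 x) Ax in ltAm.
rewrite !inE => /andP[yx Ay]; have [g Vg [gy0 gA]] := fA y Ay.
exists g; last by split=> // z; rewrite !inE => /andP[_]; apply: gA.
apply/memv_capP; split=> //; apply/lker_pullbackP => _.
by apply: gA; rewrite ?max_x // eq_sym.
Qed.

(** A filtration bound: the maps [h v] pick out pieces of [T], and the functions
    of [V] that vanish on the pieces before [v] restrict on the piece [v] to a
    space that contains [X v]. Each piece contributes the dimension of that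
    restriction, by the rank theorem. *)
Lemma sum_dim_filtration (F : fieldType) (S T : finType) m
    (V : {vspace {ffun T -> F^o}}) (h : 'I_m -> S -> T)
    (X : 'I_m -> seq {ffun S -> F^o}) :
    (forall v w, w \in X v -> exists2 f : {ffun T -> F^o}, f \in V &
      (forall u : 'I_m, (u < v)%N -> forall x, f (h u x) = 0) /\
      (forall x, f (h v x) = w x)) ->
  (\sum_v \dim <<X v>> <= \dim V)%N.
Proof.
elim: m V h X => [|m IHm] V h X liftX; first by rewrite big_ord0.
rewrite big_ord_recl -(limg_ker_dim (linfun (@pullback F S T (h ord0))) V).
rewrite addnC leq_add //.
  apply: (IHm _ (fun u => h (lift ord0 u)) (fun u => X (lift ord0 u))) => v w Xw.
  have [f Vf [f0 fw]] := liftX _ _ Xw; exists f.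
    by apply/memv_capP; split=> //; apply/lker_pullbackP/f0.
  by split=> // u ltuv; apply: f0; rewrite ltnS.
apply/dimvS/span_subvP => w Xw; have [f Vf [_ fw]] := liftX _ _ Xw.
suff -> : w = linfun (@pullback F S T (h ord0)) f by rewrite memv_img.
by apply/ffunP => x; rewrite lfunE ffunE fw.
Qed.

(** Orthogonality for the nondegenerate diagonal form with weights [w] says that
    the product of a matrix of rank [\dim V] and a matrix of rank [\dim W] is 0. *)
Lemma dim_orthogonal (F : fieldType) (T : finType) (w : T -> F)
    (V W : {vspace {ffun T -> F^o}}) :
    (forall x, w x != 0) ->
    (forall f g : {ffun T -> F^o}, f \in V -> g \in W ->
       \sum_x w x * f x * g x = 0) ->
  (\dim V + \dim W <= #|T|)%N.
Proof.
move=> w0 orth.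
(* One rank computation serves both factors: the weights are 1 for V and w
   for W. *)
have rankB (u : T -> F) (Z : {vspace {ffun T -> F^o}}) : (forall x, u x != 0) ->
    \rank (\matrix_(i < \dim Z, j < #|T|)
             (u (enum_val j) * (vbasis Z)`_i (enum_val j)))%R = \dim Z.
  move=> u0; apply/eqP; apply: inj_row_free => a aM0; apply/rowP => i.
  rewrite mxE; apply: (freeP (basis_free (vbasisP Z)) (a 0)).
  apply/ffunP => x; rewrite sum_ffunE ffunE; apply: (mulfI (u0 x)).
  have /rowP/(_ (enum_rank x)) := aM0; rewrite !mxE mulr0; apply: etrans.
  rewrite mulr_sumr; apply: eq_bigr => k _.
  by rewrite !mxE ffunE enum_rankK mulrCA.
rewrite -(rankB (fun=> 1) V) ?oner_eq0 // -(rankB w W) //.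
rewrite -[X in (_ + X <= _)%N]mxrank_tr; apply: mulmx0_rank_max.
apply/matrixP => i j; rewrite !mxE.
rewrite -[RHS](orth (vbasis V)`_i (vbasis W)`_j).
- rewrite [RHS](reindex (@enum_val T T)) /=; last exact: onW_bij (enum_val_bij T).
  by apply: eq_bigr => x _; rewrite !mxE mul1r mulrA [w _ * _]mulrC.
- by apply/vbasis_mem/mem_nth; rewrite size_tuple.
- by apply/vbasis_mem/mem_nth; rewrite size_tuple.
Qed.

End FunctionSpaces.

(** * Polynomials with bounded exponents, as functions of a permutation *)

Section PermutationPolynomials.
Import GRing.Theory.
Local Open Scope ring_scope.

Lemma size_prod_XsubC_cond (F : fieldType) (I : finType) (P : pred I) (b : I -> F) :
  size (\prod_(i | P i) ('X - (b i)%:P)) = #|P|.+1.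
Proof. by rewrite -big_filter size_prod_XsubC cardE /enum_mem !size_filter. Qed.

Definition perm_monomial (F : fieldType) n (c : 'I_n -> F) (a : 'I_n -> nat) :
    {ffun 'S_n -> F^o} :=
  [ffun s : 'S_n => \prod_i c (s i) ^+ a i].

Definition perm_monomials (F : fieldType) n (c : 'I_n -> F) e :=
  [seq perm_monomial c (fun i => a i) | a : {ffun 'I_n -> 'I_e}].

(** Bounding the exponents by [e] strictly makes two spaces orthogonal as soon as
    their bounds add up to at most [n], and lets the recursion on dimensions
    start from the zero space ([e] = 0, n > 0). *)
Definition perm_poly (F : fieldType) n (c : 'I_n -> F) e :
  {vspace {ffun 'S_n -> F^o}} := <<perm_monomials c e>>%VS.

(** The way to exhibit elements of [perm_poly]: all functions built below are
    products of univariate polynomials in the single coordinates. *)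
Lemma prod_horner_perm_poly (F : fieldType) n (c : 'I_n -> F) e
    (p : 'I_n -> {poly F}) :
    (forall i, (size (p i) <= e)%N) ->
  [ffun s : 'S_n => \prod_i (p i).[c (s i)]] \in perm_poly c e.
Proof.
move=> le_p_e.
suff -> : [ffun s : 'S_n => \prod_i (p i).[c (s i)]] =
    \sum_(a : {ffun 'I_n -> 'I_e})
      (\prod_i (p i)`_(a i)) *: perm_monomial c (fun i => a i)
      :> {ffun 'S_n -> F^o}.
  apply: rpred_sum => a _; apply: rpredZ; apply: memv_span.
  by apply/imageP; exists a.
apply/ffunP => s; rewrite ffunE sum_ffunE.
under eq_bigr do rewrite (horner_coef_wide _ (le_p_e _)).
rewrite bigA_distr_bigA; apply: eq_bigr => a _.
by rewrite !ffunE big_split.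
Qed.

Lemma perm_polyS (F : fieldType) n (c : 'I_n -> F) e e' :
  (e <= e')%N -> (perm_poly c e <= perm_poly c e')%VS.
Proof.
move=> le_ee'; apply/span_subvP => _ /imageP[a _ ->].
suff -> : perm_monomial c (fun i => a i) =
    [ffun s : 'S_n => \prod_i ('X^(a i)).[c (s i)]].
  by apply: prod_horner_perm_poly => i; rewrite size_polyXn (leq_trans (ltn_ord _)).
by apply/ffunP => s; rewrite !ffunE; apply: eq_bigr => i _; rewrite hornerXn.
Qed.

(** The alternating sum is the determinant of the generalized Vandermonde matrix
    with rows (c_j ^ a_i)_j. There are n rows but at most n - 1 exponents, so two
    rows are equal. *)
Lemma sum_sign_perm_monomial (F : fieldType) n (c : 'I_n -> F) (a : 'I_n -> nat) :
    (0 < n)%N -> (forall i, (a i < n.-1)%N) ->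
  \sum_(s : 'S_n) (-1) ^+ s * perm_monomial c a s = 0.
Proof.
move=> n_gt0 lt_a.
pose M : 'M[F]_n := \matrix_(i, j) c j ^+ a i.
have -> : \sum_(s : 'S_n) (-1) ^+ s * perm_monomial c a s = \det M.
  apply: eq_bigr => s _; rewrite ffunE; congr (_ * _).
  by apply: eq_bigr => i _; rewrite mxE.
have /injectivePn[i [j neq_ij eq_a]] : ~~ injectiveb (fun i => Ordinal (lt_a i)).
  apply/negP => /injectiveP/leq_card; rewrite !card_ord.
  by rewrite leqNgt prednK ?leqnn.
apply: (determinant_alternate neq_ij) => k; rewrite !mxE.
by case: eq_a => ->.
Qed.

(** A product of one monomial from each space has all exponents at most
    d + e - 2 < n - 1, so the two spaces are orthogonal for the form weighted by
    the signature. *)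
Lemma dim_perm_polyD (F : fieldType) n (c : 'I_n -> F) d e :
    (0 < n)%N -> (d + e <= n)%N ->
  (\dim (perm_poly c d) + \dim (perm_poly c e) <= n`!)%N.
Proof.
move=> n_gt0 le_de_n; rewrite -(card_Sn n).
apply: (@dim_orthogonal F _ (fun s : 'S_n => (-1) ^+ s)) => [s|f g Vf Vg].
  by rewrite signr_eq0.
elim/span_ffun_ind: f / Vf => [|a f1 f2 IH1 IH2|_ /imageP[a _ ->]].
- by rewrite big1 // => s _; rewrite ffunE mulr0 mul0r.
- transitivity (a * (\sum_(x : 'S_n) (-1) ^+ x * f1 x * g x) +
                \sum_(x : 'S_n) (-1) ^+ x * f2 x * g x).
    rewrite mulr_sumr -big_split; apply: eq_bigr => s _.
    by rewrite !ffunE mulrDr mulrDl !mulrA [_ * a]mulrC.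
  by rewrite IH1 IH2 mulr0 addr0.
elim/span_ffun_ind: g / Vg => [|x f1 f2 IH1 IH2|_ /imageP[b _ ->]].
- by rewrite big1 // => s _; rewrite !ffunE mulr0.
- move: (perm_monomial _ _) IH1 IH2 => f IH1 IH2.
  transitivity (x * (\sum_(s : 'S_n) (-1) ^+ s * f s * f1 s) +
                \sum_(s : 'S_n) (-1) ^+ s * f s * f2 s).
    rewrite mulr_sumr -big_split; apply: eq_bigr => s _.
    by rewrite ffunE mulrDr mulrCA.
  by rewrite IH1 IH2 mulr0 addr0.
rewrite -[RHS](@sum_sign_perm_monomial F n c (fun i => a i + b i)%N) //.
  apply: eq_bigr => s _; rewrite !ffunE -mulrA -big_split; congr (_ * _).
  by apply: eq_bigr => i _; rewrite exprD.
by move=> i; have := ltn_ord (a i); have := ltn_ord (b i); lia.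
Qed.

End PermutationPolynomials.

(** * The recursion for the number of excedances *)

Section ExcedanceRecursion.

(** In cycle notation, the new largest letter is inserted just after [x.2]; it
    becomes a fixed point when [x.2] is itself the new letter. *)
Definition insert_max n (x : 'S_n * 'I_n.+1) : 'S_n.+1 :=
  (tperm x.2 ord_max * lift_perm ord_max ord_max x.1)%g.

Lemma insert_max_bij n : bijective (@insert_max n).
Proof.
apply: inj_card_bij => [[p i] [q j] eq_pq|]; last first.
  by rewrite card_prod card_ord !card_Sn factS mulnC.
have preim r k : insert_max (r, k) k = ord_max :> 'I_n.+1.
  by rewrite permM tpermL lift_perm_id.
have eq_ij : i = j.
  by apply: (@perm_inj _ (insert_max (p, i))); rewrite preim eq_pq preim.
move: eq_pq; rewrite /insert_max /= eq_ij => /mulgI eq_pq.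
congr (_, _); apply/permP => k; apply: (@lift_inj _ (ord_max : 'I_n.+1)).
by rewrite -!(lift_perm_lift ord_max) eq_pq.
Qed.

Lemma exc_sum n (p : 'S_n) : exc p = \sum_(i < n) (i < p i).
Proof. by rewrite /exc -sum1dep_card big_mkcond. Qed.

Lemma exc_leq n (p : 'S_n) : exc p <= n.
Proof. by rewrite /exc (leq_trans (max_card _)) ?card_ord. Qed.

Lemma exc_lt n (p : 'S_n.+1) : exc p < n.+1.
Proof.
have card_nmax : #|[set~ (ord_max : 'I_n.+1)]| = n by rewrite cardsC1 card_ord.
rewrite ltnS -[X in _ <= X]card_nmax.
apply/subset_leq_card/subsetP => i; rewrite !inE; apply: contraTneq => ->.
by rewrite -leqNgt -ltnS ltn_ord.
Qed.

Lemma widen_ord_lift_max n (i : 'I_n) : widen_ord (leqnSn n) i = lift ord_max i.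
Proof. exact/val_inj/esym/lift_max. Qed.

Lemma exc_insert_max n (p : 'S_n) : exc (insert_max (p, ord_max)) = exc p.
Proof.
rewrite !exc_sum big_ord_recr /= permM tpermR lift_perm_id ltnn addn0.
apply: eq_bigr => i _; rewrite widen_ord_lift_max.
by rewrite permM tpermD ?neq_lift // lift_perm_lift !lift_max.
Qed.

(** The arrow j -> p j is replaced by j -> max -> p j: the first new arrow always
    is an excedance and the second never is, so the count grows unless [j] was
    already an excedance. *)
Lemma exc_insert_lift n (p : 'S_n) (j : 'I_n) :
  exc (insert_max (p, lift ord_max j)) = exc p + ~~ (j < p j).
Proof.
rewrite !exc_sum big_ord_recr /= permM tpermR lift_perm_lift lift_max.
rewrite [n < _]ltnNge ltnW ?ltn_ord // addn0.
rewrite (bigD1 j) // [in RHS](bigD1 j) //= widen_ord_lift_max.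
rewrite permM tpermL lift_perm_id ltn_ord addnAC [_ + ~~ _]addnC addn_negb.
congr (_ + _); apply: eq_bigr => i neq_ij; rewrite widen_ord_lift_max permM.
rewrite tpermD ?neq_lift 1?(inj_eq lift_inj) 1?eq_sym //.
by rewrite lift_perm_lift !lift_max.
Qed.

(** Among the n + 1 insertions into a permutation with k excedances, exactly
    n - k produce a further one. Counting the permutations with more than k
    excedances, rather than those with exactly k, gives the combination that
    the dimension bound produces. *)
Lemma card_leq_exc_rec n k :
  #|[set s : 'S_n.+1 | k < exc s]| =
    k.+1 * #|[set s : 'S_n | k < exc s]|
    + (n - k) * #|[set s : 'S_n | k <= exc s]|.
Proof.
rewrite -!sum1dep_card !big_distrr /= (reindex _ (onW_bij _ (insert_max_bij n))).
rewrite (big_mkcond (fun s : 'S_n => k < exc s)).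
rewrite (big_mkcond (fun s : 'S_n => k <= exc s)) -big_split /=.
rewrite big_mkcond /=.
rewrite -(pair_bigA _ (fun p i => nat_of_bool (k < exc (insert_max (p, i))))) /=.
apply: eq_bigr => p _; rewrite big_ord_recr /= exc_insert_max !muln1.
under eq_bigr do rewrite widen_ord_lift_max exc_insert_lift.
case: (ltngtP k (exc p)) => [lt_k_p | lt_p_k | eq_k_p].
- under eq_bigr do rewrite ltn_addr //.
  rewrite sum_nat_const card_ord muln1.
  by have := leq_trans lt_k_p (exc_leq p); lia.
- rewrite big1 // => i _.
  by case: (i < p i) => /=; lia.
rewrite eq_k_p add0n addn0.
have -> : n - exc p = \sum_(i < n) ~~ (i < p i).
  apply/eqP; rewrite -(eqn_add2l (exc p)) subnKC ?exc_leq // exc_sum -big_split /=.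
  under eq_bigr do rewrite addnC addn_negb.
  by rewrite sum_nat_const card_ord muln1.
by apply: eq_bigr => i _; case: (i < p i); rewrite /= ?addn0 ?addn1 ?ltnn ?leqnn.
Qed.

End ExcedanceRecursion.

(** * A lower bound for the dimension *)

Section LowerBound.
Import GRing.Theory.
Local Open Scope ring_scope.

Lemma lift_perm_pieces (F : fieldType) n e (c : 'I_n.+1 -> F)
    (q0 : {poly F}) (q : 'I_n -> {poly F}) :
    (size q0 <= e)%N -> (forall i, (size (q i) <= e)%N) ->
  exists2 f : {ffun 'S_n.+1 -> F^o}, f \in perm_poly c e &
    forall u (p : 'S_n),
      f (lift_perm ord0 u p) = q0.[c u] * \prod_i (q i).[c (lift u (p i))].
Proof.
move=> le_q0 le_q.
pose r i := if unlift ord0 i is Some j then q j else q0.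
exists [ffun s : 'S_n.+1 => \prod_i (r i).[c (s i)]].
  by apply: prod_horner_perm_poly => i; rewrite /r; case: unliftP.
move=> u p; rewrite ffunE big_ord_recl /r unlift_none lift_perm_id; congr (_ * _).
by apply: eq_bigr => i _; rewrite liftK lift_perm_lift.
Qed.

(** S_(n+1) is cut into pieces by the value v at the first position, and each
    piece is a copy of S_n acting on the other values. For the first e + 1 values
    v, the product of x_0 - c_u over u < v kills the earlier pieces and costs no
    degree in the other variables. For larger v, the product of c_v - x_i over
    i > 0 kills all other pieces, since each of them takes the value v at some
    i > 0; it costs one degree in each of these variables. *)
Lemma sum_dim_perm_poly_lift (F : fieldType) n (c : 'I_n.+1 -> F) e :
    injective c ->
  (\sum_v \dim (perm_poly (c \o lift v) (if (v < e.+1)%N then e.+1 else e))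
     <= \dim (perm_poly c e.+1))%N.
Proof.
move=> c_inj.
apply: (sum_dim_filtration (h := fun v p => lift_perm ord0 v p)) => v w.
case: ifP => [lt_v_e | /negbT le_e_v] /imageP[a _ ->].
  (* C and its counterpart below are the constant values of the killing factor
     on the piece v; dividing by them makes the restriction exact. *)
  pose C := \prod_(u : 'I_n.+1 | (u < v)%N) (c v - c u).
  have C0 : C != 0.
    apply/prodf_neq0 => u lt_uv; rewrite subr_eq0 (inj_eq c_inj).
    by apply: contraTneq lt_uv => ->; rewrite ltnn.
  have [||f Vf fE] := @lift_perm_pieces F n e.+1 c
      (C^-1 *: \prod_(u : 'I_n.+1 | (u < v)%N) ('X - (c u)%:P))
      (fun i => 'X^(a i)).
  - apply: leq_trans (size_scale_leq _ _) _.
    rewrite size_prod_XsubC_cond (leq_trans _ lt_v_e) // ltnS.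
    rewrite -sum1_card -(big_ord_widen _ (fun=> 1%N) (ltnW (ltn_ord v))).
    by rewrite sum1_card card_ord.
  - by move=> i; rewrite size_polyXn.
  exists f => //; split=> [u lt_uv p | p]; rewrite fE hornerZ horner_prod.
    by rewrite (bigD1 u) //= hornerXsubC subrr mul0r mulr0 mul0r.
  under eq_bigr do rewrite hornerXsubC.
  rewrite -/C mulVf // mul1r ffunE.
  by apply: eq_bigr => i _; rewrite hornerXn.
pose C := \prod_(i < n) (c v - c (lift v i)).
have C0 : C != 0.
  by apply/prodf_neq0 => i _; rewrite subr_eq0 (inj_eq c_inj) neq_lift.
have [||f Vf fE] := @lift_perm_pieces F n e.+1 c
    (C^-1)%:P (fun i => ((c v)%:P - 'X) * 'X^(a i)).
- exact: leq_trans (size_polyC_leq1 _) _.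
- move=> i; apply: leq_trans (size_polyMleq _ _) _.
  by rewrite size_polyXn -opprB size_polyN size_XsubC add2n /= ltnS ltn_ord.
exists f => //; split=> [u lt_uv p | p]; rewrite fE hornerC.
  have [j vE | vE] := unliftP u v; last by rewrite vE ltnn in lt_uv.
  by rewrite (bigD1 (p^-1 j)%g) //= permKV -vE hornerM hornerD hornerN hornerC hornerX
             subrr !mul0r mulr0.
under eq_bigr do rewrite hornerM hornerXn hornerD hornerN hornerC hornerX.
rewrite big_split /= [X in _ * (X * _)](_ : _ = C); last first.
  by rewrite [RHS](reindex_inj (@perm_inj _ p)).
by rewrite mulKf // ffunE.
Qed.

(** Induction on n: the pieces of [sum_dim_perm_poly_lift] are bounded by the
    induction hypothesis, k decreasing for the small values v and e for the large
    ones. In S_(n+1) there are e pieces of the first kind and n + 1 - e of the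
    second, which are the coefficients in [card_leq_exc_rec]. The embedding [c] must be arbitrary because each piece
    omits a different value. *)
Lemma card_exc_leq_dim (F : fieldType) n k e (c : 'I_n -> F) :
    injective c -> (k + e)%N = n ->
  (#|[set s : 'S_n | (k <= exc s)%N]| <= \dim (perm_poly c e))%N.
Proof.
elim: n k e c => [|n IHn] k e c c_inj.
  move/eqP; rewrite addn_eq0 => /andP[/eqP-> /eqP->].
  (* S_0 has one element, and the empty monomial does not vanish there. *)
  apply: (@leq_card_dim_triangular F _ _ (fun=> 0%N)) => s _.
  exists [ffun t : 'S_0 => \prod_i (1 : {poly F}).[c (t i)]].
    by apply: prod_horner_perm_poly => -[].
  split=> [|t _]; first by rewrite ffunE big_ord0 oner_eq0.
  by rewrite (_ : t = s) ?eqxx //; apply/permP => -[].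
case: e => [|e] ke.
  rewrite (_ : [set _ | _] = set0) ?cards0 //; apply/setP => s; rewrite !inE.
  by apply/negbTE; rewrite -ltnNge -[k]addn0 ke exc_lt.
apply: leq_trans (sum_dim_perm_poly_lift e c_inj).
have lift_inj_c v : injective (c \o lift v) by move=> i j /c_inj/lift_inj.
(* For k = 0 all permutations are counted, and on each piece the monomials with
   exponents smaller than n already span all functions. *)
case: k ke => [|k] ke.
  rewrite add0n in ke; case: ke => ->.
  rewrite [X in (X <= _)%N](_ : _ = \sum_(v < n.+1) n`!)%N; last first.
    rewrite sum_nat_const card_ord -factS -card_Sn.
    by apply: eq_card => s; rewrite !inE.
  apply: leq_sum => v _; rewrite ltn_ord.
  rewrite -card_Sn; apply: leq_trans (dimvS (perm_polyS _ (leqnSn n))).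
  apply: leq_trans (IHn 0%N n _ (lift_inj_c v) (add0n n)).
  by apply/eq_leq/eq_card => s; rewrite !inE.
rewrite card_leq_exc_rec.
have -> : (n - k = e.+1)%N by lia.
apply: (@leq_trans (\sum_(v < n.+1) if (v < e.+1)%N
    then #|[set s : 'S_n | (k <= exc s)%N]|
    else #|[set s : 'S_n | (k < exc s)%N]|)%N).
  rewrite -(big_mkord xpredT (fun v => if (v < e.+1)%N then _ else _)).
  rewrite (@big_cat_nat _ _ _ e.+1) //=; last by lia.
  rewrite addnC leq_add //.
    rewrite (eq_big_nat _ _ (F2 := fun=> #|[set s : 'S_n | (k <= exc s)%N]|)).
      by rewrite sum_nat_const_nat subn0.
    by move=> v /andP[_ ->].
  rewrite (eq_big_nat _ _ (F2 := fun=> #|[set s : 'S_n | (k < exc s)%N]|)).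
    by rewrite sum_nat_const_nat -ke addnK.
  by move=> v /andP[]; rewrite ltnS leqNgt => /negPf ->.
by apply: leq_sum => v _; case: ifP => _; apply: IHn => //; lia.
Qed.

End LowerBound.

(** * Independent polynomials from a strategy *)

Section StrategyBound.
Import GRing.Theory.

(** The sizes of the feedback sets are at most n, so reading them as digits in
    base n + 1 turns the lexicographic order into the order of numbers. *)
Definition history_code n (h : seq {set 'I_n}) :=
  foldl (fun r (U : {set 'I_n}) => r * n.+1 + #|U|) 0 h.

(** As long as the histories agree, the guesses do, and the hypothesis makes the
    feedback for t a subset of the feedback for s; the first proper inclusion
    makes a digit drop and decides the comparison. *)
Lemma history_code_decreasing n (St : strategy n) (s t : 'S_n) m :
    (forall j i, j < m -> guess St s j.+1 i != s i -> guess St s j.+1 i != t i) ->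
  history St t m = history St s m \/
  history_code (history St t m) < history_code (history St s m).
Proof.
elim: m => [|m IHm] miss; first by left.
have code_rcons h (U : {set 'I_n}) :
    history_code (rcons h U) = history_code h * n.+1 + #|U|.
  by rewrite /history_code foldl_rcons.
have [j i lt_jm|eq_h|lt_h] := IHm; first by apply: miss; apply: leqW.
  rewrite /= eq_h; set g := St _.
  have sub_ts : feedback g t \subset feedback g s.
    apply/subsetP => i; rewrite !inE; apply: contraTT => gs.
    exact: (miss m i (ltnSn m)).
  case: (eqVneq (feedback g t) (feedback g s)) => [-> | neq_ts]; first by left.
  right; rewrite !code_rcons ltn_add2l.
  by apply: proper_card; rewrite properEneq neq_ts.
right; rewrite !code_rcons.
have le_n (U : {set 'I_n}) : #|U| <= n by rewrite (leq_trans (max_card _)) ?card_ord.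
apply: leq_trans (leq_addr _ _); apply: leq_trans (leq_mul lt_h (leqnn n.+1)).
by rewrite mulSn addnC ltn_add2r ltnS.
Qed.

Lemma eq_history_leq n (St : strategy n) (s t : 'S_n) j m : j <= m ->
  history St s m = history St t m -> history St s j = history St t j.
Proof.
elim: m => [|m IHm]; first by rewrite leqn0 => /eqP ->.
rewrite leq_eqVlt => /predU1P[-> // | lt_jm] /= /rcons_inj[eq_m _].
exact: IHm.
Qed.

(** The shorter of the two games ends either with the last guess, the same for
    both secrets, or earlier; then its full feedback is part of the common
    history, and that guess is right for both. *)
Lemma solved_same_history n (St : strategy n) (s t : 'S_n) d :
    solves_within St s d.+1 -> solves_within St t d.+1 ->
  history St s d = history St t d -> s = t.
Proof.
move=> /existsP[j /eqP solve_s] /existsP[k /eqP solve_t].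
wlog le_jk : s t j k solve_s solve_t / j <= k => [hwlog eq_h | eq_h].
  by case/orP: (leq_total j k) => [/hwlog|/hwlog/(_ (esym eq_h))->] //; apply.
apply/permP => i; have := ltn_ord j; rewrite ltnS leq_eqVlt => /predU1P[jd | lt_jd].
  have kd : k = j.
    by apply/val_inj/eqP; rewrite eqn_leq le_jk andbT [val j]jd -ltnS ltn_ord.
  move: solve_t; rewrite kd /guess /= jd -eq_h -jd => solve_t.
  by move: solve_s; rewrite /guess /= solve_t => /ffunP/(_ i); rewrite !ffunE.
have /= /rcons_inj[eq_hj eq_U] := eq_history_leq lt_jd eq_h.
move: eq_U; rewrite -eq_hj -[St _]/(guess St s j.+1) solve_s => /setP/(_ i).
by rewrite !inE !ffunE eqxx => /esym/eqP.
Qed.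

Lemma card_solved_leq_dim (F : fieldType) n (c : 'I_n -> F) (St : strategy n) d :
    injective c ->
  #|[set s : 'S_n | solves_within St s d.+1]| <= \dim (perm_poly c d.+1).
Proof.
move=> c_inj.
apply: (leq_card_dim_triangular
  (rho := fun s => history_code (history St s d))) => s; rewrite inE => solve_s.
pose p i : {poly F} :=
  (\prod_(j < d | guess St s j.+1 i != s i) ('X - (c (guess St s j.+1 i))%:P))%R.
exists [ffun t : 'S_n => \prod_i (p i).[c (t i)]]%R.
  apply: prod_horner_perm_poly => i; rewrite /p size_prod_XsubC_cond ltnS.
  by rewrite (leq_trans (max_card _)) ?card_ord.
split=> [|t]; rewrite ffunE.
  apply/prodf_neq0 => i _; rewrite horner_prod; apply/prodf_neq0 => j miss.
  by rewrite hornerXsubC subr_eq0 (inj_eq c_inj) eq_sym.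
rewrite inE => solve_t neq_ts le_code; apply/eqP; apply: contraT => /prodf_neq0 nz.
case: (@history_code_decreasing _ St s t d) => [j i lt_jd miss|eq_h|].
- have := nz i isT; rewrite horner_prod => /prodf_neq0/(_ (Ordinal lt_jd) miss).
  by rewrite hornerXsubC subr_eq0 (inj_eq c_inj) eq_sym.
- by rewrite (solved_same_history solve_t solve_s eq_h) eqxx in neq_ts.
- by rewrite ltnNge le_code.
Qed.

End StrategyBound.

(** * The bound *)

Theorem theorem10 (n : nat) (hn : 1 <= n) (St : strategy n) (d : nat) :
  #|[set s : 'S_n | solves_within St s d.+1]| <=
    \sum_(0 <= k < d.+1) eulerian n k.
Proof.
have -> : \sum_(0 <= k < d.+1) eulerian n k = #|[set s : 'S_n | exc s < d.+1]|.
  rewrite big_mkord -sum1dep_card.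
  rewrite (partition_big (fun s : 'S_n => inord (exc s) : 'I_d.+1) predT) //=.
  apply: eq_bigr => k _; rewrite /eulerian -sum1dep_card.
  apply: eq_bigl => s; apply/eqP/andP => [-> | [lt_s_d /eqP <-]].
    by rewrite ltn_ord inord_val eqxx.
  by rewrite inordK.
have card_exc : #|[set s : 'S_n | exc s < d.+1]|
    + #|[set s : 'S_n | d.+1 <= exc s]| = n`!.
  rewrite -card_Sn -[RHS](cardsC [set s : 'S_n | exc s < d.+1]).
  by congr (_ + _); apply: eq_card => s; rewrite !inE -leqNgt.
have [lt_nd | le_dn] := ltnP n d.+1.
  rewrite -(leq_add2r #|[set s : 'S_n | d.+1 <= exc s]|) card_exc.
  rewrite [X in _ + X](_ : _ = 0) ?addn0 -?card_Sn ?max_card //.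
  apply: eq_card0 => s; rewrite !inE.
  by apply/negbTE; rewrite -ltnNge (leq_ltn_trans (exc_leq s)).
pose c (i : 'I_n) : rat := (i%:R)%R.
have c_inj : injective c.
  by move=> i j /eqP; rewrite Num.Theory.eqr_nat => /eqP/val_inj.
rewrite -(leq_add2r #|[set s : 'S_n | d.+1 <= exc s]|) card_exc.
apply: leq_trans (dim_perm_polyD c hn (d := d.+1) (e := n - d.+1) _).
  by rewrite leq_add ?card_solved_leq_dim ?card_exc_leq_dim ?subnKC.
by rewrite subnKC.
Qed.
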